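(* Let $A=(a_n)_{n=1}^{\infty}$ be a sequence of positive numbers such that \[ a_1+\sum_{n=1}^{\infty}\frac{a_{n+1}}{a_n}<\frac{1}{8}. \] Then the set \[ F=\bigcup_{n=1}^{\infty}3^{-n}(1+A) \] is bi-Lipschitz measure universal.
   Context: A sequence $A=(a_n)_{n=1}^\infty$ is identified with the set $\{a_n: n\ge 1\}$, and $3^{-n}(1+A)=\{3^{-n}(1+a): a\in A\}$. A map $f:\mathbb{R}\to\mathbb{R}$ is bi-Lipschitz if there exists a constant $L>1$ such that $L^{-1}|x-y|\le |f(x)-f(y)|\le L|x-y|$ for all $x,y\in\mathbb{R}$. A set $P\subset\mathbb{R}$ is bi-Lipschitz measure universal if for every Lebesgue measurable set $E\subset\mathbb{R}$ of positive Lebesgue measure there is a bi-Lipschitz map $f:\mathbb{R}\to\mathbb{R}$ with $f(P)\subset E$. *)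

(* Defs.v *)
From HB Require Import structures.
From mathcomp Require Import all_boot all_order all_algebra.
From mathcomp Require Import all_classical all_reals all_analysis.

Set Implicit Arguments.
Unset Strict Implicit.
Unset Printing Implicit Defensive.

Import Order.TTheory GRing.Theory Num.Theory.
Import numFieldNormedType.Exports.

Local Open Scope classical_set_scope.
Local Open Scope ring_scope.

(* [measurable] on [R] is only the Borel sigma-algebra. The Lebesgue
   measurable sets are the Caratheodory measurable sets of the Lebesgue outer
   measure, i.e. the domain of [completed_lebesgue_measure]; see also
   [completed_caratheodory_measurable]. *)
Definition lebesgue_measurable (R : realType) (E : set R) : Prop :=
  ((wlength (@idfun R))^*)%mu.-cara.-measurable E.

Definition bilipschitz (R : realType) (f : R -> R) : Prop :=
  exists2 L : R, 1 < L &
    forall x y : R, L^-1 * `|x - y| <= `|f x - f y| <= L * `|x - y|.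

Definition bilipschitz_measure_universal (R : realType) (P : set R) : Prop :=
  forall E : set R, lebesgue_measurable E ->
    (0 < completed_lebesgue_measure E)%E ->
    exists2 f : R -> R, bilipschitz f & f @` P `<=` E.

(* Main.v *)
(* At a density point [x] of [E] and for a small [d], put [rho_n = d 3^-n]. A
   rising sun argument gives, slightly to the right of [x + rho_n], a base point
   [x + rho_n (1 + t_n)] at which the complement of [E] has density at most 1/4
   in every interval to the right, up to length of order [rho_n]. So for every
   [k] the set [E] meets the interval [x + rho_n (1 + t_n + a_k [1, 2])]. As [A]
   decreases faster than 8^-k, sending [3^-n (1 + a_k)] to such a point has
   difference quotients within [d / 3] and [3 d], and a McShane-type formula
   extends this map from [F] to the line. *)
Require Import Defs.
From HB Require Import structures.
From mathcomp Require Import all_boot all_order all_algebra.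
From mathcomp Require Import ring lra.
From mathcomp Require Import all_classical all_reals all_analysis.

Set Implicit Arguments.
Unset Strict Implicit.
Unset Printing Implicit Defensive.

Import Order.TTheory GRing.Theory Num.Theory.
Import numFieldNormedType.Exports.

Local Open Scope classical_set_scope.
Local Open Scope ring_scope.

(** * Extension of bi-Lipschitz maps to the line *)

(** As [L^-1 < L], the maximum is linear with slope [L] right of the origin and slope [L^-1] left of
    it. *)
Lemma max_slope (R : realType) (L x y : R) : 1 < L -> x <= y ->
  L^-1 * (y - x) <= Num.max (L * y) (L^-1 * y) - Num.max (L * x) (L^-1 * x)
    <= L * (y - x).
Proof.
move=> L1 xy.
have L0 : 0 < L by lra.
have LV : L^-1 < L by rewrite (lt_trans _ L1)// invf_lt1.
have LV0 : 0 < L^-1 by rewrite invr_gt0.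
move: (L^-1) LV LV0 => M ML M0.
have maxE t : Num.max (L * t) (M * t) = if 0 <= t then L * t else M * t.
  by case: ifPn => t0; [apply/max_idPl|apply/max_idPr]; nra.
by rewrite !maxE; case: ifPn => hy; case: ifPn => hx; apply/andP; split; nra.
Qed.

(* The McShane extension, with the kernel [L |t|] replaced by the increasing
   function [max (L t) (t / L)] so as to keep the lower bound on slopes too. *)
Lemma bilipschitz_extension (R : realType) (I : pointedType) (p g : I -> R)
    (L : R) : 1 < L ->
  (forall i j, p i <= p j ->
    L^-1 * (p j - p i) <= g j - g i <= L * (p j - p i)) ->
  exists2 f : R -> R, bilipschitz f & forall i, f (p i) = g i.
Proof.
move=> L1 slope.
have L0 : 0 < L by lra.
pose psi t := Num.max (L * t) (L^-1 * t).
have psiB (x y : R) : x <= y -> L^-1 * (y - x) <= psi y - psi x <= L * (y - x).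
  exact: max_slope.
pose S x := [set g i + psi (x - p i) | i in [set: I]].
(* At [x = p i] no member of [S x] lies below [g i], so the infimum takes the prescribed value
   there. *)
have gpsi i j : g i <= g j + psi (p i - p j).
  have [/slope/andP[+ _]|/ltW/slope/andP[_ +]] := leP (p i) (p j).
    have : L^-1 * (p i - p j) <= psi (p i - p j) by rewrite le_max lexx orbT.
    lra.
  have : L * (p i - p j) <= psi (p i - p j) by rewrite le_max lexx.
  lra.
have S0 x : S x !=set0 by exists (g point + psi (x - p point)), point.
have Slb x : has_lbound (S x).
  (* From [p point - p j] to [x - p j] the function [psi] drops by at most [L * |x - p point|], so
     [gpsi] gives a bound uniform in [j]. *)
  exists (g point - L * `|x - p point|) => _ [j _ <-].
  have gj := gpsi point j.
  have [xp|/ltW px] := leP x (p point).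
    have /psiB/andP[_] : x - p j <= p point - p j by lra.
    rewrite ler0_norm ?subr_le0//; lra.
  have /psiB/andP[+ _] : p point - p j <= x - p j by lra.
  have : 0 <= L^-1 * (x - p j - (p point - p j)).
    by rewrite mulr_ge0 ?invr_ge0 ?(ltW L0)//; lra.
  have : 0 <= L * `|x - p point| by rewrite mulr_ge0 ?(ltW L0).
  lra.
have Sle x i : inf (S x) <= g i + psi (x - p i) by apply: ge_inf => //; exists i.
(* Each function of the family has slopes between [L^-1] and [L], and such bounds pass to the
   infimum. *)
have infB x y : x <= y ->
    L^-1 * (y - x) <= inf (S y) - inf (S x) <= L * (y - x).
  move=> xy; have psii i := psiB _ _ (lerB xy (lexx (p i))).
  apply/andP; split.
    rewrite lerBrDr; apply: lb_le_inf => // _ [i _ <-].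
    by have := Sle x i; have /andP[] := psii i; lra.
  suff : inf (S y) - L * (y - x) <= inf (S x) by lra.
  apply: lb_le_inf => // _ [i _ <-].
  by have := Sle y i; have /andP[] := psii i; lra.
exists (fun x => inf (S x)).
  exists L => // x y; wlog xy : x y / x <= y.
    move=> wlg; have [/wlg//|/ltW/wlg] := leP x y.
    by rewrite distrC (distrC (inf _)).
  have /andP[lo hi] := infB _ _ xy.
  have lo0 : 0 <= L^-1 * (y - x) by rewrite mulr_ge0 ?invr_ge0 ?(ltW L0)//; lra.
  rewrite distrC ger0_norm ?subr_ge0// distrC ger0_norm ?(le_trans lo0)//.
  exact/andP.
move=> i; apply/eqP; rewrite eq_le; apply/andP; split.
  by rewrite (le_trans (Sle _ i))// subrr /psi !mulr0 maxxx addr0.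
by apply: lb_le_inf => // _ [j _ <-].
Qed.

(** * Density of Borel sets *)

(** A set of the completion is a Borel set joined with part of a Borel null set, so the Borel part
    carries all the measure. *)
Lemma lebesgue_measurable_borel_subset (R : realType) (E : set R) :
  lebesgue_measurable E -> (0 < completed_lebesgue_measure E)%E ->
  exists B : set R,
    [/\ measurable B, B `<=` E & (0 < lebesgue_measure B)%E].
Proof.
rewrite /lebesgue_measurable -completed_caratheodory_measurable.
rewrite g_sigma_completed_algebra_genE => -[B mB [N [M [mM M0 NM]] <-]] E0.
exists B; split => [||]; [exact: mB|by move=> x Bx; left|].
rewrite (lt_le_trans E0)// -[leRHS]adde0 -M0.
apply: le_trans (outer_measureU2 (wlength (@idfun R))^*%mu B M).
by apply: le_outer_measure; apply: setUS.
Qed.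

(** By the Lebesgue density theorem, the points of [B] where [B] does not have density 1 lie in a
    null set, so they cannot exhaust [B]. *)
Lemma exists_density_point (R : realType) (B : set R) (e : R) :
  measurable B -> (0 < lebesgue_measure B)%E -> 0 < e ->
  exists x : R, exists2 r : R, 0 < r & forall s, 0 < s -> s < r ->
    (lebesgue_measure (ball x s `\` B) <= (e * s)%:E)%E.
Proof.
move=> mB B0 e0.
have [x Bx dx] : exists2 x, B x &
    (lebesgue_measure (B `&` ball x r) * (lebesgue_measure (ball x r))^-1)%E
      @[r --> 0^'+] --> (\1_B x)%:E.
  apply: contrapT => nx; have [N [mN N0 sN]] := lebesgue_density mB.
  move: B0; rewrite -N0 ltNge => /negP; apply.
  apply: le_measure; rewrite ?inE// => x Bx; apply: sN => /= dx.
  by apply: nx; exists x.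
exists x.
move: dx; rewrite indicE mem_set// => dx.
(* A ball of radius [s] has length [2 s], so a relative defect of [e / 2] amounts to [e * s]. *)
have : \forall r \near 0^'+, ((1 - e / 2)%:E <
    lebesgue_measure (B `&` ball x r) * (lebesgue_measure (ball x r))^-1)%E.
  apply: (dx (fun y => (1 - e / 2)%:E < y)%E).
  apply: open_nbhs_nbhs; split; first exact: open_ereal_gt_ereal.
  by rewrite /= lte_fin; lra.
move=> [r /= r0 hr]; exists r => // s s0 sr.
have bs : lebesgue_measure (ball x s) = (s *+ 2)%:E.
  by rewrite lebesgue_measure_ball// ltW.
have := hr s.
rewrite /ball_/= sub0r normrN gtr0_norm// => /(_ sr s0).
rewrite bs; set m := lebesgue_measure _ => mlt.
have mfin : m \is a fin_num.
  rewrite ge0_fin_numE ?measure_ge0// (@le_lt_trans _ _ (s *+ 2)%:E) ?ltry//.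
  rewrite -bs le_measure ?inE//; last exact: measurable_realfun.measurable_ball.
  by apply: measurableI => //; exact: measurable_realfun.measurable_ball.
have -> : lebesgue_measure (ball x s `\` B) = ((s *+ 2)%:E - m)%E.
  rewrite measureD//; last 2 first.
  - exact: measurable_realfun.measurable_ball.
  - by rewrite [ltLHS]bs ltry.
  by rewrite -bs /m setIC.
move: mlt; rewrite -(fineK mfin) [(_^-1)%E]inver mulrn_eq0/= gt_eqF// -EFinM -EFinB.
rewrite lte_fin lee_fin ltr_pdivlMr ?mulrn_wgt0// (mulr2n s); nra.
Qed.

(* The rising sun argument: [x] maximises [y |-> mu (]u, y] `&` D) - c (y - u)]
   on the segment from [u] to [v]. *)
Lemma exists_small_right_density (R : realType) (D : set R) (u v c : R) :
  measurable D -> u <= v ->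
  exists2 x, u <= x <= v &
    ((c * (x - u))%:E <= lebesgue_measure (`]u, v] `&` D))%E /\
    forall y, x <= y <= v ->
      (lebesgue_measure (`]x, y] `&` D) <= (c * (y - x))%:E)%E.
Proof.
move=> mD uv.
pose h x y := lebesgue_measure (`]x, y] `&` D).
have mh (x y : R) : measurable (`]x, y] `&` D) by exact: measurableI.
have h_le x y : x <= y -> (h x y <= (y - x)%:E)%E.
  move=> xy; apply: (@le_trans _ _ (lebesgue_measure (`]x, y] : set R))).
    apply: le_measure; rewrite ?inE//; exact: mh.
  rewrite lebesgue_measure_itv/= lte_fin; case: ifPn => // _.
  by rewrite lee_fin subr_ge0.
have h_fin x y : h x y \is a fin_num.
  rewrite ge0_fin_numE ?measure_ge0//.
  have [/h_le hxy|yx] := leP x y; first by rewrite (le_lt_trans hxy)// ltry.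
  by rewrite /h set_itv_ge ?set0I ?measure0 ?ltry// bnd_simp -leNgt ltW.
pose G y := fine (h u y).
have G_homo x y : x <= y -> G x <= G y.
  move=> xy; rewrite /G fine_le//; apply: le_measure; rewrite ?inE; [exact: mh|exact: mh|].
  apply: setSI => t/=; rewrite !in_itv/= => /andP[-> tx].
  exact: le_trans xy.
have G_le x y : x <= y -> G y <= G x + (y - x).
  move=> xy; rewrite -lee_fin EFinD !fineK//.
  apply: (@le_trans _ _ (h u x + h x y)%E); last by rewrite leeD2l ?h_le.
  apply: (le_trans _ (measureU2 (@lebesgue_measure R) (mh u x) (mh x y))).
  apply: le_measure; rewrite ?inE; [exact: mh|by apply: measurableU; exact: mh|].
  rewrite -setIUl; apply: setSI => t/=; rewrite !in_itv/= => /andP[-> ->].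
  by case: (leP t x) => ?; [left|right].
have GB x y : u <= x -> x <= y -> (h x y = (G y - G x)%:E).
  move=> ux xy; rewrite EFinB !fineK//.
  have -> : h u y = (h u x + h x y)%E.
    rewrite -[RHS]measureU; [|exact: mh|exact: mh|]; last first.
      rewrite -subset0 => t [[/= tx _] [/= xt _]]; move: tx xt.
      by rewrite !in_itv/= => /andP[_ tx] /andP[]; rewrite ltNge tx.
    rewrite -setIUl; congr (lebesgue_measure (_ `&` _)).
    by rewrite (@itv_bndbnd_setU _ _ _ (BRight x))// bnd_simp.
  by rewrite (addeC (h u x)) addeK.
(* [G] is nondecreasing and 1-Lipschitz; its continuity is what makes the maximum of [phi]
   attained. *)
have G_cont : continuous G.
  move=> x; apply/cvgrPdist_le => e e0; near=> y.
  have : `|x - y| < e by near: y; exists e.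
  by have [/[dup]/G_homo + /G_le|/ltW/[dup]/G_homo + /G_le] := leP x y;
    rewrite ltr_norml ler_norml; lra.
pose phi y := G y - c * (y - u).
have [x xuv xmax] : exists2 x, x \in `[u, v] &
    forall y, y \in `[u, v] -> phi y <= phi x.
  apply: EVT_max => //; apply: continuous_subspaceT => x.
  apply: continuousB; first exact: G_cont.
  apply: continuousM; first exact: cvg_cst.
  by apply: continuousB => //; exact: cvg_cst.
move: xuv; rewrite in_itv/= => /andP[ux xv].
exists x; [exact/andP|split].
  (* Maximality against [u] bounds [x - u]; against the points right of [x] it bounds the
     density. *)
  have := xmax u; rewrite in_itv/= lexx uv => /(_ isT).
  rewrite /phi subrr mulr0 subr0 => Gux.
  rewrite -/(h u v) -(fineK (h_fin u v)) lee_fin -/(G v).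
  have := G_homo _ _ xv; have : 0 <= G u by rewrite fine_ge0 ?measure_ge0.
  by move: Gux; lra.
move=> y /andP[xy yv]; have := xmax y.
rewrite in_itv/= yv (le_trans ux)// => /(_ isT).
rewrite /phi -/(h x y) GB// lee_fin; lra.
Unshelve. all: by end_near. Qed.

(* A hole of [E] between [u + rho (t + b)] and [u + rho (t + 2 b)] would fill
   half of the interval from [u + rho t], more than the quarter allowed. *)
Lemma exists_dilation_hits (R : realType) (E : set R) (u rho : R) :
  measurable E -> 0 < rho ->
  (lebesgue_measure (`]u, (u + rho / 2)%R] `\` E) <= (rho / 16)%:E)%E ->
  exists2 t, 0 <= t <= 4^-1 & forall b, 0 < b -> b < 8^-1 ->
    exists2 s, 1 <= s <= 2 & E (u + rho * (t + b * s)).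
Proof.
move=> mE rho0 small.
have [x /andP[ux xv] [xu dens]] : exists2 x, u <= x <= u + rho / 2 &
    ((4^-1 * (x - u))%:E <=
      lebesgue_measure (`]u, (u + rho / 2)%R] `&` ~` E))%E /\
    forall y, x <= y <= u + rho / 2 ->
      (lebesgue_measure (`]x, y] `&` ~` E) <= (4^-1 * (y - x))%:E)%E.
  by apply: exists_small_right_density; [exact: measurableC|lra].
(* The complement of [E] has measure at most [rho / 16] here; with density 1/4 this limits the shift
   to [rho / 4]. *)
have {small xu} xu : 4^-1 * (x - u) <= rho / 16.
  by rewrite -lee_fin (le_trans xu).
have xE : x = u + rho * ((x - u) / rho).
  by rewrite mulrCA divff ?gt_eqF// mulr1; ring.
exists ((x - u) / rho).
  rewrite divr_ge0 ?ler_pdivrMr ?(ltW rho0)//; lra.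
move=> b b0 b8; apply: contrapT => nE.
have rb0 : 0 < rho * b by rewrite mulr_gt0.
have rb : rho * b < rho * 8^-1 by rewrite ltr_pM2l.
have hole : `](x + rho * b), (x + rho * b * 2)] `<=`
    `]x, (x + rho * b * 2)] `&` ~` E.
  move=> y /=; rewrite !in_itv/= => /andP[y1 y2].
  split; first by apply/andP; split; lra.
  move=> Ey; apply: nE; exists ((y - x) / (rho * b)).
    rewrite ler_pdivlMr ?ler_pdivrMr//; lra.
  rewrite mulrDr addrA -xE mulrA mulrC divfK ?gt_eqF//.
  by rewrite addrC subrK.
have mhole : lebesgue_measure (`](x + rho * b)%R, (x + rho * b * 2)%R] : set R)
    = (rho * b)%:E.
  rewrite lebesgue_measure_itv/= lte_fin ltrD2l ltr_pMr// ltr1n -EFinB.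
  by congr _%:E; ring.
(* As [x <= u + rho / 4] and [b < 1/8], the interval ends before [u + rho / 2], within reach of
   [dens]. *)
have : ((rho * b)%:E <= (4^-1 * (x + rho * b * 2 - x))%:E)%E.
  apply: le_trans (dens (x + rho * b * 2) _); last by apply/andP; split; lra.
  rewrite -mhole; apply: le_measure; rewrite ?inE//.
  by apply: measurableI => //; exact: measurableC.
by rewrite lee_fin; lra.
Qed.

(** * Decay of the sequence and slope estimates *)

(** All terms are nonnegative, so the total dominates each of them. *)
Lemma ratio_sum_bounds (R : realType) (a : nat -> R) (r : R) :
  (forall n, 0 < a n) ->
  ((a 0%N)%:E + \sum_(0 <= n <oo) (a n.+1 / a n)%:E < r%:E)%E ->
  a 0%N < r /\ forall n, a n.+1 < r * a n.
Proof.
move=> a_gt0; have q0 n : (0 <= (a n.+1 / a n)%:E)%E.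
  by rewrite lee_fin divr_ge0 ?ltW.
have s0 : (0 <= \sum_(0 <= n <oo) (a n.+1 / a n)%:E)%E by exact: nneseries_ge0.
move=> sr; split.
  by rewrite -lte_fin (le_lt_trans _ sr)// leeDl.
move=> n; rewrite -ltr_pdivrMr// -lte_fin (le_lt_trans _ sr)//.
rewrite -[leLHS]add0e leeD ?lee_fin ?(ltW (a_gt0 _))//.
rewrite (le_trans _ (nneseries_lim_ge n.+1 _))//.
by rewrite big_nat_recr//= leeDr// sume_ge0.
Qed.

Lemma geometric_decay (R : realFieldType) (a : nat -> R) (r : R) (k l : nat) :
  r <= 1 -> (forall n, 0 < a n) -> (forall n, a n.+1 < r * a n) ->
  (k < l)%N -> a l < r * a k.
Proof.
move=> r1 a_gt0 dec; elim: l => // l IH.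
rewrite ltnS leq_eqVlt => /predU1P[->//|/IH].
by have := dec l; have := a_gt0 l; nra.
Qed.

(** [x] is an increment between source points and [y] the one between their images; [0 < x] records
    the order of the source points. *)
Definition slope_within (R : numDomainType) (L x y : R) :=
  0 < x /\ L^-1 * x <= y <= L * x.

(** The source increment lies between [5 r / 8] and [9 r / 8], the image increment between [r / 2]
    and [3 r / 2]. *)
Lemma slope_across_scales (R : realFieldType) (r r' a a' s s' t t' : R) :
  0 < r' -> r' <= r / 3 ->
  0 < a < 8^-1 -> 0 < a' < 8^-1 -> 0 <= t <= 4^-1 -> 0 <= t' <= 4^-1 ->
  1 <= s <= 2 -> 1 <= s' <= 2 ->
  slope_within 3 (r * (1 + a) - r' * (1 + a'))
    (r * (1 + t + a * s) - r' * (1 + t' + a' * s')).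
Proof.
move=> r'0 r'r a08 a'08 t04 t'04 s12 s'12.
have as4 : 0 <= a * s <= 4^-1 by apply/andP; split; nra.
have as4' : 0 <= a' * s' <= 4^-1 by apply/andP; split; nra.
move: (a * s) as4 (a' * s') as4' => w w4 w' w'4.
by rewrite /slope_within; split; [nra|apply/andP; split; nra].
Qed.

(** The common shift [t] cancels. The source increment lies between [7 r a / 8] and [r a], the image
    increment between [3 r a / 4] and [2 r a]. *)
Lemma slope_within_scale (R : realFieldType) (r a a' s s' t : R) :
  0 < r -> 0 < a -> 0 < a' -> a' < 8^-1 * a -> 1 <= s <= 2 -> 1 <= s' <= 2 ->
  slope_within 3 (r * (1 + a) - r * (1 + a'))
    (r * (1 + t + a * s) - r * (1 + t + a' * s')).
Proof.
move=> r0 a0 a'0 a'a s12 s'12.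
have w12 : a <= a * s <= 2 * a by apply/andP; split; nra.
have w'12 : a' <= a' * s' <= 2 * a' by apply/andP; split; nra.
move: (a * s) w12 (a' * s') w'12 => w wa w' w'a.
by rewrite /slope_within; split; [nra|apply/andP; split; nra].
Qed.

(** Supplies the slope hypothesis of [bilipschitz_extension], up to the factor [d], by comparing
    first the scales and then the indices in [a]. *)
Lemma perturbed_slopes (R : realFieldType) (a t : nat -> R)
    (s : nat -> nat -> R) (i j : nat * nat) :
  let p i := 3 ^- i.1.+1 * (1 + a i.2) in
  let z i := 3 ^- i.1.+1 * (1 + t i.1 + a i.2 * s i.1 i.2) in
  (forall k, 0 < a k < 8^-1) ->
  (forall k l, (k < l)%N -> a l < 8^-1 * a k) ->
  (forall n, 0 <= t n <= 4^-1) -> (forall n k, 1 <= s n k <= 2) ->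
  p i <= p j -> 3^-1 * (p j - p i) <= z j - z i <= 3 * (p j - p i).
Proof.
move=> p z a8 dec t4 s2 pij.
have r0 n : 0 < 3 ^- n :> R by rewrite invr_gt0 exprn_gt0.
have rS m n : (m < n)%N -> 3 ^- n <= 3 ^- m / 3 :> R.
  move=> mn; rewrite -invfM -exprSr lef_pV2 ?posrE ?exprn_gt0//.
  by rewrite ler_weXn2l// ler1n.
have [ij|ji|ij] := ltngtP i.1 j.1.
(* A smaller exponent puts [p i] right of [p j], contrary to [pij]. *)
- have [] := @slope_across_scales R _ _ _ _ (s i.1 i.2) (s j.1 j.2) _ _
    (r0 j.1.+1) (rS i.1.+1 j.1.+1 ij) (a8 i.2) (a8 j.2) (t4 i.1) (t4 j.1)
    (s2 _ _) (s2 _ _).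
  by rewrite subr_gt0 ltNge pij.
- by have [] := @slope_across_scales R _ _ _ _ (s j.1 j.2) (s i.1 i.2) _ _
    (r0 i.1.+1) (rS j.1.+1 i.1.+1 ji) (a8 j.2) (a8 i.2) (t4 j.1) (t4 i.1)
    (s2 _ _) (s2 _ _).
move: pij; rewrite /p /z {p z}; case: i j ij => [n k] [n' l] /= <-{n'} pij.
have a0 m : 0 < a m by have /andP[] := a8 m.
have [kl|lk|->] := ltngtP k l.
(* This order contradicts [pij] too; only the source increment matters, so the shift is set to 0. *)
- have [] := @slope_within_scale R _ _ _ (s n k) (s n l) 0
    (r0 n.+1) (a0 k) (a0 l) (dec _ _ kl) (s2 _ _) (s2 _ _).
  by rewrite subr_gt0 ltNge pij.
- by have [] := @slope_within_scale R _ _ _ (s n l) (s n k) (t n)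
    (r0 n.+1) (a0 l) (a0 k) (dec _ _ lk) (s2 _ _) (s2 _ _).
by rewrite !subrr !mulr0 lexx.
Qed.

(* Sequences are indexed from 0: [a n] stands for the term a_(n+1), and the
   n-th set of the union carries the factor 3^-(n+1). *)
Theorem theorem1p4 (R : realType) (a : nat -> R)
    (a_gt0 : forall n : nat, 0 < a n)
    (a_sum : ((a 0%N)%:E + \sum_(0 <= n <oo) (a n.+1 / a n)%:E < (8^-1)%:E)%E) :
  bilipschitz_measure_universal
    (\bigcup_(n : nat) [set 3 ^- n.+1 * (1 + x) | x in range a]).
Proof.
have [a0 dec] := ratio_sum_bounds a_gt0 a_sum.
have decay k l : (k < l)%N -> a l < 8^-1 * a k by apply: geometric_decay => //; lra.
have a8 k : 0 < a k < 8^-1.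
  by rewrite a_gt0/=; case: k => // k; have := decay 0%N k.+1 isT; lra.
move=> E mE E0.
have [B [mB BE B0]] := lebesgue_measurable_borel_subset mE E0.
(* On a ball of radius [rho n * 2] this leaves a defect of [rho n / 16], as [exists_dilation_hits]
   asks. *)
have e0 : 0 < 32^-1 :> R by rewrite invr_gt0.
have [x [r r0 dens]] := exists_density_point mB B0 e0.
(* [d <= r] keeps the radii [rho n * 2] below [r]; [d <= 1] makes [3 / d] a valid constant for
   slopes between [d / 3] and [3 * d]. *)
pose d := Num.min 1 r.
have d0 : 0 < d by rewrite lt_min ltr01.
have d1 : d <= 1 by rewrite ge_min lexx.
have dr : d <= r by rewrite ge_min lexx orbT.
pose rho n := d * 3 ^- n.+1.
have rho0 n : 0 < rho n by rewrite mulr_gt0// invr_gt0 exprn_gt0.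
have rhor n : rho n * 2 < r.
  have : (3 ^- n.+1 : R) <= 3^-1.
    by rewrite lef_pV2 ?posrE ?exprn_gt0// ler_eXnr// ler1n.
  by move=> h; have : rho n <= d * 3^-1; [rewrite ler_pM2l|lra].
have /choice[t /all_and2[t4 /choice[s hits]]] n : exists t, 0 <= t <= 4^-1 /\
    exists s : nat -> R, forall k, 1 <= s k <= 2 /\
      B (x + d * (3 ^- n.+1 * (1 + t + a k * s k))).
  have [||t t4 hit] := @exists_dilation_hits R B (x + rho n) (rho n) mB => //.
    apply: (@le_trans _ _ (32^-1 * (rho n * 2))%:E); last first.
      by rewrite lee_fin; lra.
    rewrite (le_trans _ (dens (rho n * 2) _ _)) ?mulr_gt0//.
    apply: le_measure; rewrite ?inE.
    - exact: measurableD.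
    - by apply: measurableD => //; exact: measurable_realfun.measurable_ball.
    (* The interval from [x + rho n] to [x + 3 * rho n / 2] lies in the ball of radius [rho n * 2]
       around [x]. *)
    apply: setSD => y; rewrite /= in_itv/= => /andP[y1 y2].
    rewrite /ball/= ltr_norml; have := rho0 n; lra.
  exists t; split=> //.
  have /choice[s hs] k : exists s, 1 <= s <= 2 /\
      B (x + d * (3 ^- n.+1 * (1 + t + a k * s))).
    have /andP[ak0 ak8] := a8 k; have [s s2 Bs] := hit _ ak0 ak8.
    exists s; split => //; move: Bs; congr B.
    by rewrite /rho; ring.
  by exists s.
pose p (i : nat * nat) := 3 ^- i.1.+1 * (1 + a i.2).
pose z (i : nat * nat) := 3 ^- i.1.+1 * (1 + t i.1 + a i.2 * s i.1 i.2).
have [||f bf fp] := @bilipschitz_extension R _ p (fun i => x + d * z i) (3 / d).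
- by rewrite ltr_pdivlMr// mul1r; lra.
- move=> i j pij.
  have s2 n k : 1 <= s n k <= 2 by have [] := hits n k.
  have := perturbed_slopes a8 decay t4 s2 pij.
  rewrite -/(p i) -/(p j) -/(z i) -/(z j) => /andP[lo hi].
  have -> : x + d * z j - (x + d * z i) = d * (z j - z i) by ring.
  rewrite invf_div -mulrA ler_pM2l// lo/=.
  rewrite (le_trans (_ : _ <= 3 * (p j - p i)))//.
    by rewrite (le_trans _ hi)// ler_piMl//; lra.
  by rewrite ler_wpM2r ?subr_ge0// ler_pdivlMr//; lra.
exists f => // _ [_ [n _ [_ [k _ <-] <-]] <-]; apply: BE.
by rewrite (fp (n, k)); have [] := hits n k.
Qed.
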